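(* Let $\mathbb{P}$ be a forcing and let $\kappa$ be a cardinal. (1) The following implications hold: $$\mathsf{FA}_{\mathbb{P},\kappa}\Rightarrow\Sigma_0^{(\mathrm{sim})}\text{-}\mathsf{N}_{\mathbb{P},\kappa}(\infty)\Rightarrow\mathsf{N}_{\mathbb{P},\kappa}(\infty)\Rightarrow\mathsf{FA}_{\mathbb{P},\kappa}.$$ (2) For any ordinal $\alpha>0$ and any transitive set $X$ of size at most $\kappa$, $$\mathsf{FA}_{\mathbb{P},\kappa}\Rightarrow\Sigma_0^{(\mathrm{sim})}\text{-}\mathsf{N}_{\mathbb{P},X,\kappa}(\alpha)\Rightarrow\mathsf{N}_{\mathbb{P},X,\kappa}(\alpha),$$ and if $|\mathcal{P}^{<\alpha}(X)|\geq\kappa$, then moreover $\mathsf{N}_{\mathbb{P},X,\kappa}(\alpha)\Rightarrow\mathsf{FA}_{\mathbb{P},\kappa}$.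
   Context: A forcing is a partial order with a largest element $1$; $\mathbb{P}\Vdash\varphi$ means $1\Vdash\varphi$; $V$ is the ground model. $\mathsf{FA}_{\mathbb{P},\kappa}$: for any sequence $\langle D_\gamma\mid\gamma<\kappa\rangle$ of dense subsets of $\mathbb{P}$ there is a filter $g\in V$ on $\mathbb{P}$ with $g\cap D_\gamma\neq\emptyset$ for all $\gamma<\kappa$. Iterated power sets: $\mathcal{P}^0(X)=X$, $\mathcal{P}^{<\alpha}(X)=\bigcup_{\beta<\alpha}\mathcal{P}^\beta(X)$, and $\mathcal{P}^\alpha(X)=\mathcal{P}(\mathcal{P}^{<\alpha}(X))$ for $\alpha>0$. Rank of names: a name $\sigma$ is a rank $0$ $X$-name if $\sigma=\check{x}$ for some $x\in X$; otherwise $\sigma$ is a rank $\alpha$ $X$-name, where $\alpha=\sup\{\mathrm{rank}(\tau)+1\mid\exists p\in\mathbb{P}\ (\tau,p)\in\sigma\}$. (Every $\mathbb{P}$-name is an $X$-name of some rank.) A name $\sigma$ is locally $\kappa$-small if there are at most $\kappa$ many names $\tau$ such that $(\tau,p)\in\sigma$ for some $p$. It is $\kappa$-small if it is locally $\kappa$-small and each such $\tau$ is (recursively) $\kappa$-small. For a filter $g$ (not assumed generic), $\sigma^g=\{\tau^g\mid\exists p\in g\ (\tau,p)\in\sigma\}$. $H_{\kappa^+}$ is the set of sets hereditarily of size at most $\kappa$. $\mathsf{N}_{\mathbb{P},X,\kappa}(\alpha)$ (for $X$ transitive of size at most $\kappa$): whenever $\sigma$ is a $\kappa$-small $X$-name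 of rank $\leq\alpha$ and $A\in H_{\kappa^+}\cap\mathcal{P}^\alpha(X)$ is such that $\mathbb{P}\Vdash\sigma=\check{A}$, there is a filter $g\in V$ on $\mathbb{P}$ with $\sigma^g=A$. $\mathsf{N}_{\mathbb{P},\kappa}(\infty)$: $\mathsf{N}_{\mathbb{P},X,\kappa}(\alpha)$ holds for all ordinals $\alpha$ and all transitive $X\in H_{\kappa^+}$. $\Sigma_0^{(\mathrm{sim})}\text{-}\mathsf{N}_{\mathbb{P},X,\kappa}(\alpha)$: whenever $\sigma_0,\dots,\sigma_n$ are $\kappa$-small $X$-names of rank $\leq\alpha$, there is a filter $g\in V$ on $\mathbb{P}$ such that $\varphi(\sigma_0^g,\dots,\sigma_n^g)$ holds in $V$ for every $\Sigma_0$-formula $\varphi$ (bounded quantifiers allowed) with $\mathbb{P}\Vdash\varphi(\sigma_0,\dots,\sigma_n)$. $\Sigma_0^{(\mathrm{sim})}\text{-}\mathsf{N}_{\mathbb{P},\kappa}(\infty)$: the same statement for $\kappa$-small $X$-names $\sigma_0,\dots,\sigma_n$ of arbitrary rank, for some transitive $X\in H_{\kappa^+}$. *)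

(* Defs.v *)
From HB Require Import structures.
From Stdlib Require Import Relation_Operators Wellfounded.
From mathcomp Require Import all_boot.
From mathcomp Require Import boolp classical_sets functions cardinality.

Set Implicit Arguments.
Unset Strict Implicit.
Unset Printing Implicit Defensive.

Local Open Scope classical_set_scope.
Local Open Scope card_scope.
Local Open Scope quotient_scope.

(** * The ground model

    [V] is Aczel's universe of well-founded trees with small branching, modulo
    extensional equality.  Equality of sets is Leibniz equality on [V]; since
    the metatheory is classical with choice, [V] satisfies ZFC, with separation
    and replacement for arbitrary predicates and functions. *)

Inductive tree : Type := node (A : Type) (f : A -> tree).

Fixpoint teq (s t : tree) : Prop :=
  match s, t with
  | node A f, node B g =>
      (forall a, exists b, teq (f a) (g b)) /\
      (forall b, exists a, teq (f a) (g b))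
  end.

Lemma teq_refl s : teq s s.
Proof. by elim: s => A f IH /=; split=> a; exists a. Qed.

Lemma teq_sym s t : teq s t -> teq t s.
Proof.
elim: s t => A f IH [B g] /= [h1 h2]; split=> [b|a].
  by have [a h] := h2 b; exists a; apply: IH.
by have [b h] := h1 a; exists b; apply: IH.
Qed.

Lemma teq_trans s t u : teq s t -> teq t u -> teq s u.
Proof.
elim: s t u => A f IH [B g] [C h] /= [h1 h2] [k1 k2]; split=> [a|c].
  have [b hb] := h1 a; have [c hc] := k1 b.
  by exists c; apply: IH hb hc.
have [b hb] := k2 c; have [a ha] := h2 b.
by exists a; apply: IH ha hb.
Qed.

HB.instance Definition _ := gen_eqMixin tree.
HB.instance Definition _ := gen_choiceMixin tree.

Definition teqb (s t : tree) : bool := `[< teq s t >].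

Lemma teqb_equiv : equiv_class_of teqb.
Proof.
split.
- by move=> s; apply/asboolP; apply: teq_refl.
- by move=> s t; apply/idP/idP => /asboolP h; apply/asboolP; apply: teq_sym.
- move=> t s u /asboolP h1 /asboolP h2; apply/asboolP; exact: teq_trans h1 h2.
Qed.

Canonical teqb_equivRel := EquivRelPack teqb_equiv.

Definition V : Type := {eq_quot teqb}.
HB.instance Definition _ := Choice.on V.

Definition tree_of (x : V) : tree := repr (x : {eq_quot teqb}).

Definition mkset (A : Type) (f : A -> V) : V :=
  \pi_({eq_quot teqb}) (node (fun a => tree_of (f a))).

Definition branches (t : tree) : Type := let: node A _ := t in A.
Definition child (t : tree) : branches t -> tree :=
  match t with node _ f => f end.

Definition idx (x : V) : Type := branches (tree_of x).
Definition el (x : V) (i : idx x) : V := \pi_({eq_quot teqb}) (child i).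

Definition mem (y x : V) : Prop := exists i : idx x, y = el i.

Notation "y ∈ x" := (mem y x) (at level 70, no associativity).

Definition elts (x : V) : set V := [set y | y ∈ x].

Definition sub (x y : V) : Prop := forall z, z ∈ x -> z ∈ y.

Lemma teq_pi s t : teq s t <-> \pi_({eq_quot teqb}) s = \pi_({eq_quot teqb}) t.
Proof.
split=> [h|/eqquotP/asboolP //].
by apply/eqquotP; apply/asboolP.
Qed.

Lemma pi_tree_of x : \pi_({eq_quot teqb}) (tree_of x) = x.
Proof. exact: reprK. Qed.

Lemma tree_of_pi t : teq (tree_of (\pi_({eq_quot teqb}) t)) t.
Proof. by apply/teq_pi; rewrite pi_tree_of. Qed.

Lemma mem_pi y (A : Type) (f : A -> tree) :
  y ∈ \pi_({eq_quot teqb}) (node f) <-> exists a, y = \pi_({eq_quot teqb}) (f a).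
Proof.
rewrite /mem /idx /el.
have := tree_of_pi (node f).
case: (tree_of _) => B g /= [h1 h2]; split=> [[b ->]|[a ->]].
  by have [a h] := h1 b; exists a; apply/teq_pi.
by have [b h] := h2 a; exists b; apply/teq_pi/teq_sym.
Qed.

Lemma mem_mkset y (A : Type) (f : A -> V) : y ∈ mkset f <-> exists a, y = f a.
Proof.
rewrite /mkset mem_pi; split=> -[a ->]; exists a; first by rewrite pi_tree_of.
by rewrite pi_tree_of.
Qed.

Lemma mem_el (x : V) (i : idx x) : el i ∈ x.
Proof. by exists i. Qed.

Lemma V_ext (x y : V) : (forall z, z ∈ x <-> z ∈ y) -> x = y.
Proof.
rewrite -(pi_tree_of x) -(pi_tree_of y).
case: (tree_of x) => A f; case: (tree_of y) => B g h.
apply/teq_pi => /=; split=> [a|b].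
  have /h : \pi_({eq_quot teqb}) (f a) ∈ \pi_({eq_quot teqb}) (node f).
    by apply/mem_pi; exists a.
  by move=> /mem_pi[b hb]; exists b; apply/teq_pi.
have /h : \pi_({eq_quot teqb}) (g b) ∈ \pi_({eq_quot teqb}) (node g).
  by apply/mem_pi; exists b.
by move=> /mem_pi[a ha]; exists a; apply/teq_pi.
Qed.

Lemma mem_wf : well_founded mem.
Proof.
have acc t x : x = \pi_({eq_quot teqb}) t -> Acc mem x.
  elim: t x => A f IH x ->; constructor=> y /mem_pi[a ->].
  exact: IH.
by move=> x; apply: (acc (tree_of x)); rewrite pi_tree_of.
Qed.

Definition empty : V := mkset (fun a : False => match a with end).
Definition upair (x y : V) : V := mkset (fun b : bool => if b then x else y).
Definition kpair (x y : V) : V := upair (upair x x) (upair x y).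
Definition union (x : V) : V :=
  mkset (fun k : {i : idx x & idx (el i)} => el (projT2 k)).
Definition sep (x : V) (S : V -> Prop) : V :=
  mkset (fun k : {i : idx x | S (el i)} => el (proj1_sig k)).
Definition repl (f : V -> V) (x : V) : V := mkset (fun i : idx x => f (el i)).
Definition powerset (x : V) : V :=
  mkset (fun S : idx x -> Prop => mkset (fun k : {i | S i} => el (proj1_sig k))).
Definition succ (x : V) : V := union (upair x (upair x x)).

Lemma mem_empty y : ~ y ∈ empty.
Proof. by rewrite /empty mem_mkset => -[[]]. Qed.

Lemma mem_upair z x y : z ∈ upair x y <-> z = x \/ z = y.
Proof.
rewrite /upair mem_mkset; split=> [[[|] ->]|[->|->]]; [by left|by right| |].
  by exists true.
by exists false.
Qed.

Lemma mem_union z x : z ∈ union x <-> exists2 y, y ∈ x & z ∈ y.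
Proof.
rewrite /union mem_mkset; split=> [[[i j] ->]|[_ [i ->] [j ->]]].
  by exists (el i); apply: mem_el.
by exists (existT _ i j).
Qed.

Lemma mem_sep z x S : z ∈ sep x S <-> z ∈ x /\ S z.
Proof.
rewrite /sep mem_mkset; split=> [[[i h] ->]|[[i ->] h]].
  by split; first exact: mem_el.
by exists (exist _ i h).
Qed.

Lemma mem_repl z f x : z ∈ repl f x <-> exists2 y, y ∈ x & z = f y.
Proof.
rewrite /repl mem_mkset; split=> [[i ->]|[_ [i ->] ->]]; last by exists i.
by exists (el i); first exact: mem_el.
Qed.

Lemma mem_powerset z x : z ∈ powerset x <-> sub z x.
Proof.
rewrite /powerset mem_mkset; split=> [[S ->] y|h].
  by rewrite mem_mkset => -[[i hi] ->]; apply: mem_el.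
exists (fun i => el i ∈ z); apply: V_ext => y; rewrite mem_mkset; split.
  move=> yz; have [i e] := h _ yz; rewrite e in yz *.
  by exists (exist _ i yz).
by case=> -[i hi] ->.
Qed.

Lemma mem_succ z x : z ∈ succ x <-> z ∈ x \/ z = x.
Proof.
rewrite /succ mem_union; split=> [[y /mem_upair[->|->]]|[h|->]].
- by left.
- by move/mem_upair=> [->|->]; right.
- by exists x => //; apply/mem_upair; left.
- by exists (upair x x); apply/mem_upair; [right|left].
Qed.

Lemma upair_inj x y z t : upair x y = upair z t ->
  (x = z /\ y = t) \/ (x = t /\ y = z).
Proof.
move=> e.
have /mem_upair hx : x ∈ upair z t by rewrite -e; apply/mem_upair; left.
have /mem_upair hy : y ∈ upair z t by rewrite -e; apply/mem_upair; right.
have /mem_upair hz : z ∈ upair x y by rewrite e; apply/mem_upair; left.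
have /mem_upair ht : t ∈ upair x y by rewrite e; apply/mem_upair; right.
case: hx hy hz ht => -> [->|->] [h|h] [h'|h']; try (by left); try (by right);
  by left; split; congruence.
Qed.

Lemma kpair_inj x y z t : kpair x y = kpair z t -> x = z /\ y = t.
Proof.
by move=> /upair_inj[[/upair_inj h1 /upair_inj h2]|[/upair_inj h1 /upair_inj h2]];
  split; intuition congruence.
Qed.

(** Recursion along the transitive closure of membership: in [F x r], the
    function [r] may be used on every set below [x], and is [empty] elsewhere. *)

Definition below : V -> V -> Prop := clos_trans V mem.

Lemma below_wf : well_founded below.
Proof. exact: wf_clos_trans mem_wf. Qed.

Definition rec_step (F : V -> (V -> V) -> V) (x : V)
    (r : forall y, below y x -> V) : V :=
  F x (fun y => match pselect (below y x) with
                | left h => r y h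
                | right _ => empty
                end).

Definition mem_rec (F : V -> (V -> V) -> V) : V -> V :=
  Fix below_wf (fun _ => V) (rec_step F).

Lemma mem_recE F x :
  mem_rec F x = F x (fun y => if `[< below y x >] then mem_rec F y else empty).
Proof.
rewrite {1}/mem_rec Fix_eq; last first.
  move=> y f g fg; rewrite /rec_step; congr F; apply: funext => z.
  by case: pselect.
rewrite /rec_step; congr F; apply: funext => y.
by case: pselect => h; [rewrite (asboolT h)|rewrite (asboolF h)].
Qed.

Lemma repl_below (f : V -> V) (x y : V) : (forall z, z ∈ y -> below z x) ->
  repl (fun z => if `[< below z x >] then f z else empty) y = repl f y.
Proof.
move=> h; apply: V_ext => z; rewrite !mem_repl.
by split=> -[t ty ->]; exists t => //; rewrite (asboolT (h _ ty)).
Qed.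

(** * Ordinals, cardinals, iterated power sets *)

Definition transitive_set (x : V) : Prop := forall y, y ∈ x -> sub y x.

Definition ordinal (a : V) : Prop :=
  transitive_set a /\ forall b, b ∈ a -> transitive_set b.

Definition ord_le (a b : V) : Prop := a ∈ b \/ a = b.

Definition cardinal (k : V) : Prop :=
  ordinal k /\ forall b, b ∈ k -> ~ (elts k #<= elts b).

Definition size_le (x k : V) : Prop := elts x #<= elts k.

(** [hered_small k] is the class H_{k^+}. *)
Inductive hered_small (k : V) : V -> Prop :=
  HeredSmall x : size_le x k -> (forall y, y ∈ x -> hered_small k y) ->
    hered_small k x.

Definition Pow (X : V) : V -> V :=
  mem_rec (fun a r => if `[< a = empty >] then X
                      else powerset (union (repl r a))).

Definition Pow_lt (X a : V) : V := union (repl (Pow X) a).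

Lemma Pow0 X : Pow X empty = X.
Proof. by rewrite /Pow mem_recE asboolT. Qed.

Lemma Pow_pos X a : a <> empty -> Pow X a = powerset (Pow_lt X a).
Proof.
move=> a0; rewrite /Pow mem_recE (asboolF a0) -/(Pow X).
rewrite repl_below // => z za; exact: t_step.
Qed.

(** * Forcings and names *)

Record forcing := Forcing {
  cond : V;
  fle : V -> V -> Prop;
  one : V;
  one_cond : one ∈ cond;
  fle_refl : forall p, p ∈ cond -> fle p p;
  fle_anti : forall p q, p ∈ cond -> q ∈ cond -> fle p q -> fle q p -> p = q;
  fle_trans : forall p q r, p ∈ cond -> q ∈ cond -> r ∈ cond ->
    fle p q -> fle q r -> fle p r;
  fle_one : forall p, p ∈ cond -> fle p one
}.

Definition is_filter (P : forcing) (g : V) : Prop :=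
  [/\ sub g (cond P),
      exists p, p ∈ g,
      forall p q, p ∈ g -> q ∈ cond P -> fle P p q -> q ∈ g &
      forall p q, p ∈ g -> q ∈ g -> exists r, [/\ r ∈ g, fle P r p & fle P r q]].

Definition is_dense (P : forcing) (D : V) : Prop :=
  sub D (cond P) /\ forall p, p ∈ cond P -> exists2 q, q ∈ D & fle P q p.

Inductive is_name (P : forcing) : V -> Prop :=
  IsName s :
    (forall z, z ∈ s ->
       exists t p, [/\ z = kpair t p, p ∈ cond P & is_name P t]) ->
    is_name P s.

(** A Kuratowski pair [kpair t p] in [s] has [t] in [union (union s)]. *)
Definition names_with (g s : V) : V :=
  sep (union (union s)) (fun t => exists2 p, p ∈ g & kpair t p ∈ s).

Definition dom (P : forcing) (s : V) : V := names_with (cond P) s.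

Lemma pair_below t p s : kpair t p ∈ s ->
  t ∈ union (union s) /\ below t s.
Proof.
move=> h.
have h1 : upair t t ∈ kpair t p by apply/mem_upair; left.
have h2 : t ∈ upair t t by apply/mem_upair; left.
split.
  apply/mem_union; exists (upair t t) => //.
  by apply/mem_union; exists (kpair t p).
by apply: t_trans (t_step _ _ _ _ h2) (t_trans _ _ _ _ _ (t_step _ _ _ _ h1) _);
  apply: t_step.
Qed.

Lemma mem_names_with g s t :
  t ∈ names_with g s <-> exists2 p, p ∈ g & kpair t p ∈ s.
Proof.
rewrite /names_with mem_sep; split=> [[]//|[p pg h]].
by split; [have [] := pair_below h|exists p].
Qed.

Lemma names_with_below g s t : t ∈ names_with g s -> below t s.
Proof. by move=> /mem_names_with[p _ /pair_below[]]. Qed.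

Definition eval (g : V) : V -> V :=
  mem_rec (fun s r => repl r (names_with g s)).

Lemma evalE g s : eval g s = repl (eval g) (names_with g s).
Proof.
rewrite /eval mem_recE repl_below // => z; exact: names_with_below.
Qed.

Lemma mem_eval g s z :
  z ∈ eval g s <-> exists t p, [/\ p ∈ g, kpair t p ∈ s & z = eval g t].
Proof.
rewrite evalE mem_repl; split=> [[t /mem_names_with[p pg h] ->]|[t [p [pg h ->]]]].
  by exists t, p.
by exists t => //; apply/mem_names_with; exists p.
Qed.

Definition check (P : forcing) : V -> V :=
  mem_rec (fun x r => repl (fun y => kpair (r y) (one P)) x).

Lemma checkE P x : check P x = repl (fun y => kpair (check P y) (one P)) x.
Proof.
rewrite /check mem_recE; apply: V_ext => z; rewrite !mem_repl.
by split=> -[y yx ->]; exists y => //; rewrite (asboolT (t_step _ _ _ _ yx)).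
Qed.

(** The supremum of a set of ordinals is its union. *)
Definition name_rank (P : forcing) (X : V) : V -> V :=
  mem_rec (fun s r =>
    if `[< exists2 x, x ∈ X & s = check P x >] then empty
    else union (repl succ (repl r (dom P s)))).

Lemma name_rank0 P X s :
  (exists2 x, x ∈ X & s = check P x) -> name_rank P X s = empty.
Proof. by move=> h; rewrite /name_rank mem_recE asboolT. Qed.

Lemma name_rank_pos P X s :
  ~ (exists2 x, x ∈ X & s = check P x) ->
  name_rank P X s = union (repl succ (repl (name_rank P X) (dom P s))).
Proof.
move=> h; rewrite /name_rank mem_recE (asboolF h) repl_below // => z.
exact: names_with_below.
Qed.

Definition name_of_rank_le (P : forcing) (X a s : V) : Prop :=
  is_name P s /\ ord_le (name_rank P X s) a.

Inductive small_name (P : forcing) (k : V) : V -> Prop :=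
  SmallName s : size_le (dom P s) k ->
    (forall t, t ∈ dom P s -> small_name P k t) -> small_name P k s.

(** * Bounded formulas and the forcing relation *)

(** Formulas with free variables indexed by ['I_n]; in [FExIn i f] the new
    variable of [f], bounded by the variable [i], has index [ord0] and the old
    ones are shifted by [lift ord0].  The remaining connectives and the bounded
    universal quantifier are the usual abbreviations. *)
Inductive sigma0 : nat -> Type :=
| FMem n (i j : 'I_n) : sigma0 n
| FEq n (i j : 'I_n) : sigma0 n
| FNot n (f : sigma0 n) : sigma0 n
| FAnd n (f1 f2 : sigma0 n) : sigma0 n
| FExIn n (i : 'I_n) (f : sigma0 n.+1) : sigma0 n.

Definition env_cons n (x : V) (e : 'I_n -> V) : 'I_n.+1 -> V :=
  fun i => if unlift ord0 i is Some j then e j else x.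

Fixpoint holds n (f : sigma0 n) : ('I_n -> V) -> Prop :=
  match f with
  | FMem _ i j => fun e => e i ∈ e j
  | FEq _ i j => fun e => e i = e j
  | FNot _ f => fun e => ~ holds f e
  | FAnd _ f1 f2 => fun e => holds f1 e /\ holds f2 e
  | FExIn _ i f => fun e => exists2 x, x ∈ e i & holds f (env_cons x e)
  end.

Definition dense_below (P : forcing) (p : V) (S : V -> Prop) : Prop :=
  forall r, r ∈ cond P -> fle P r p ->
    exists q, [/\ q ∈ cond P, fle P q r & S q].

(** The usual recursive definition of forcing for equality and membership.  The
    clause for equality is a recursion along the well-founded relation "occurs
    as a name in", so its least solution is its only one. *)
Inductive forces_eq (P : forcing) : V -> V -> V -> Prop :=
  ForcesEq p a b :
    (forall c s, kpair c s ∈ a -> dense_below P p (fun q =>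
       fle P q s ->
       exists d t, [/\ kpair d t ∈ b, fle P q t & forces_eq P q c d])) ->
    (forall d t, kpair d t ∈ b -> dense_below P p (fun q =>
       fle P q t ->
       exists c s, [/\ kpair c s ∈ a, fle P q s & forces_eq P q c d])) ->
    forces_eq P p a b.

Definition forces_mem (P : forcing) (p a b : V) : Prop :=
  dense_below P p (fun q =>
    exists c s, [/\ kpair c s ∈ b, fle P q s & forces_eq P q a c]).

(** A bounded quantifier [∃ x ∈ y, f] is [∃ x, x ∈ y /\ f], with [x] ranging
    over all names. *)
Fixpoint forces (P : forcing) (p : V) n (f : sigma0 n) : ('I_n -> V) -> Prop :=
  match f with
  | FMem _ i j => fun e => forces_mem P p (e i) (e j)
  | FEq _ i j => fun e => forces_eq P p (e i) (e j)
  | FNot _ f => fun e =>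
      forall q, q ∈ cond P -> fle P q p -> ~ forces P q f e
  | FAnd _ f1 f2 => fun e => forces P p f1 e /\ forces P p f2 e
  | FExIn _ i f => fun e => dense_below P p (fun q =>
      exists t, [/\ is_name P t, forces_mem P q t (e i) &
                    forces P q f (env_cons t e)])
  end.

(** * The axioms *)

Definition FA (P : forcing) (k : V) : Prop :=
  forall D : V -> V, (forall c, c ∈ k -> is_dense P (D c)) ->
  exists2 g, is_filter P g & forall c, c ∈ k -> exists2 p, p ∈ g & p ∈ D c.

Definition Name_principle (P : forcing) (X k a : V) : Prop :=
  forall s A : V,
    name_of_rank_le P X a s -> small_name P k s ->
    hered_small k A -> A ∈ Pow X a ->
    forces_eq P (one P) s (check P A) ->
  exists2 g, is_filter P g & eval g s = A.

Definition Name_principle_inf (P : forcing) (k : V) : Prop :=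
  forall a X, ordinal a -> transitive_set X -> hered_small k X ->
    Name_principle P X k a.

Definition simultaneous (P : forcing) n (s : 'I_n.+1 -> V) : Prop :=
  exists2 g, is_filter P g &
    forall f : sigma0 n.+1,
      forces P (one P) f s -> holds f (fun i => eval g (s i)).

Definition Sigma0_sim_N (P : forcing) (X k a : V) : Prop :=
  forall n (s : 'I_n.+1 -> V),
    (forall i, name_of_rank_le P X a (s i) /\ small_name P k (s i)) ->
  simultaneous P s.

Definition Sigma0_sim_N_inf (P : forcing) (k : V) : Prop :=
  forall n (s : 'I_n.+1 -> V),
    (exists X, [/\ transitive_set X, hered_small k X &
       forall i, (exists2 a, ordinal a & name_of_rank_le P X a (s i)) /\
                 small_name P k (s i)]) ->
  simultaneous P s.

(* Main.v *)
From HB Require Import structures.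
From Stdlib Require Import Relation_Operators.
From mathcomp Require Import all_boot.
From mathcomp Require Import boolp classical_sets functions cardinality.
Require Import Defs.

Set Implicit Arguments.
Unset Strict Implicit.
Unset Printing Implicit Defensive.

Local Open Scope classical_set_scope.
Local Open Scope card_scope.

(** Why the theorem holds.

    From the forcing axiom to the simultaneous name principle: a filter that is
    generic enough satisfies the truth lemma for the given names, and genericity
    for at most kappa dense sets is enough.  Let [T] be the hereditary domain of
    the names.  For each bounded formula with parameters in [T] there is a dense
    set of conditions that decide it ([decides_dense]), where a positive
    decision exhibits a witness from [T]; boundedness of the quantifiers is what
    keeps the witnesses in [T].  A filter that meets all these sets satisfies
    the truth lemma on [T] ([truth]).  There are at most kappa such formulas,
    because [T] is reached from finitely many names along finite paths with at
    most kappa choices at each step ([card_reachable]) and because an infinite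
    cardinal equals its square ([infinite_square]).  For finite kappa there may
    be infinitely many dense sets, but they are countably many, and then the
    filter exists in every forcing ([FA_on_nat]).

    From the simultaneous principle to the name principle: the equation between
    the name and the canonical name of [A] is a bounded formula, and the
    canonical name is small and of small enough rank ([check_small],
    [check_rank]).

    From the name principle back to the forcing axiom: given dense sets [D c]
    for [c] in kappa, choose distinct small sets [f c] in the given level.  The
    name consisting of all pairs of the canonical name of [f c] and a condition
    in [D c] is forced to be the range of [f], and a filter interprets it in this
    way only if it meets every [D c] ([Name_principle_FA]). *)

(** * Cardinal arithmetic *)

Lemma card_le_inj T U (A : set T) (B : set U) (f : T -> U) :
  (forall x, A x -> B (f x)) ->
  (forall x y, A x -> A y -> f x = f y -> x = y) -> A #<= B.
Proof.
move=> fAB finj; have [] : $|{injfun A >-> B}|.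
  apply/injfunPex; exists f; first by move=> x /fAB.
  by move=> x y; rewrite !inE; exact: finj.
exact: inj_card_le.
Qed.

Lemma card_le_fun T U (A : set T) (B : set U) a : A a -> A #<= B ->
  exists f : T -> U, (forall x, A x -> B (f x)) /\
    (forall x y, A x -> A y -> f x = f y -> x = y).
Proof.
move=> Aa AB; have [[f0 _]] := card_leP AB.
pose u := f0 (SigSub (mem_set Aa)).
pose U' : pointedType := HB.pack U (gen_eqMixin U) (gen_choiceMixin U)
  (isPointed.Build U (val u)).
have /(@pcard_leP T U' A B)/injfunPex[f fAB finj] := AB.
by exists f; split=> [x /fAB//|x y Ax Ay]; apply: finj; rewrite inE.
Qed.

(** The clauses that say that a graph is an injection speak of at most two
    points of the graph at a time.  A property of this kind passes to a union
    as soon as any two points of the union lie in a good subset of it, which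
    holds for unions of chains; so there are maximal good sets, and they can be
    taken above a given one. *)
Lemma Zorn_directed T (P : set (set T)) (G0 : set T) : P G0 ->
  (forall U, (forall x y, U x -> U y ->
     exists H, [/\ P H, H `<=` U, H x & H y]) -> P U) ->
  exists G, [/\ P G, G0 `<=` G & forall H, P H -> G `<=` H -> H `<=` G].
Proof.
move=> PG0 Pdir.
have [F FP Ftot|G [PG Gmax]] := @Zorn_bigcup T [set G | P (G0 `|` G)].
  apply: Pdir => x y.
  have inF X : F X -> G0 `|` X `<=` G0 `|` \bigcup_(X in F) X.
    by move=> FX z [|Xz]; [left|right; exists X].
  have inG0 z : G0 z -> exists H, [/\ P H, H `<=` G0 `|` \bigcup_(X in F) X,
      G0 `<=` H & H z].
    by move=> ?; exists G0; split=> // ? ?; left.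
  move=> [G0x|[X FX Xx]] [G0y|[Y FY Yy]].
  - by exists G0; split=> // ? ?; left.
  - by exists (G0 `|` Y); split; [exact: FP|exact: inF|left|right].
  - by exists (G0 `|` X); split; [exact: FP|exact: inF|right|left].
  - have [XY|YX] := Ftot _ _ FX FY.
      by exists (G0 `|` Y); split;
        [exact: FP|exact: inF|right; exact: XY|right].
    by exists (G0 `|` X); split;
      [exact: FP|exact: inF|right|right; exact: YX].
exists (G0 `|` G); split=> // H PH GH x Hx.
apply: contrapT => nx; apply: (Gmax H).
  split=> [y Gy|HG]; first by apply: GH; right.
  by apply: nx; right; exact: HG.
rewrite /= setUidr // => y G0y; apply: GH; by left.
Qed.

(** A maximal injective partial map from [A] to [B] is defined everywhere or
    onto: otherwise one more pair could be added. *)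
Lemma card_le_total T U (A : set T) (B : set U) : A #<= B \/ B #<= A.
Proof.
pose P (G : set (T * U)) := [/\ forall x y, G (x, y) -> A x /\ B y,
  forall x y y', G (x, y) -> G (x, y') -> y = y' &
  forall x x' y, G (x, y) -> G (x', y) -> x = x'].
have [||G [[GAB Gfun Ginj] _ Gmax]] := @Zorn_directed _ P set0.
- by split.
- move=> W dir; split.
  + by move=> x y Wxy; have [H [[h _ _] _ Hxy _]] := dir _ _ Wxy Wxy; exact: h.
  + move=> x y y' Wy Wy'; have [H [[_ h _] _ Hy Hy']] := dir _ _ Wy Wy'.
    exact: h Hy Hy'.
  + move=> x x' y Wx Wx'; have [H [[_ _ h] _ Hx Hx']] := dir _ _ Wx Wx'.
    exact: h Hx Hx'.
have [domA|/existsNP[a /not_implyP[Aa na]]] :=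
    pselect (forall x, A x -> exists y, G (x, y)).
  left; have [->|/set0P[a Aa]] := eqVneq A set0; first exact: card_ge0.
  have [u _] := domA a Aa.
  have /choice[f fP] : forall x, exists y, A x -> G (x, y).
    by move=> x; have [/domA[y]|] := pselect (A x); [exists y|exists u].
  apply: (card_le_inj (f := f)) => [x /fP/GAB[]//|x y /fP Gx /fP Gy e].
  by rewrite e in Gx; exact: Ginj Gx Gy.
have [domB|/existsNP[b /not_implyP[Bb nb]]] :=
    pselect (forall y, B y -> exists x, G (x, y)).
  right; have /choice[f fP] : forall y, exists x, B y -> G (x, y).
    by move=> y; have [/domB[x]|] := pselect (B y); [exists x|exists a].
  apply: (card_le_inj (f := f)) => [x /fP/GAB[]//|x y /fP Gx /fP Gy e].
  by rewrite e in Gx; exact: Gfun Gx Gy.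
case: (na); exists b; apply: (Gmax (G `|` [set (a, b)])); last by right.
  split=> [x y [/GAB//|[-> ->]]//|x y y'|x x' y].
  - move=> [h|[ex ey]] [h'|[ex' ey']]; first exact: Gfun h h'.
    + by case: (na); exists y; rewrite -ex'.
    + by case: (na); exists y'; rewrite -ex.
    + by rewrite ey ey'.
  - move=> [h|[ex ey]] [h'|[ex' ey']]; first exact: Ginj h h'.
    + by case: nb; exists x; rewrite -ey'.
    + by case: nb; exists x'; rewrite -ey.
    + by rewrite ex ex'.
by move=> z; left.
Qed.

Lemma card_leX T T' U U' (A : set T) (A' : set T') (B : set U) (B' : set U') :
  A #<= B -> A' #<= B' -> A `*` A' #<= B `*` B'.
Proof.
move=> AB AB'; have [->|/set0P[[a a'] [/= Aa Aa']]] := eqVneq (A `*` A') set0.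
  exact: card_ge0.
have [f [fB finj]] := card_le_fun Aa AB.
have [f' [fB' finj']] := card_le_fun Aa' AB'.
apply: (card_le_inj (f := fun z => (f z.1, f' z.2))).
  by move=> x [/fB ? /fB' ?].
by move=> [x x'] [y y'] [/= Ax Ax'] [/= Ay Ay'] [/finj-> // /finj'->].
Qed.

(** Two distinct points of [B] serve as tags. *)
Lemma card_leU T U (A A' : set T) (B : set U) u v : B u -> B v -> u <> v ->
  A #<= B -> A' #<= B -> A `|` A' #<= B `*` B.
Proof.
move=> Bu Bv uv AB AB'.
have [->|/set0P[a Aa]] := eqVneq A set0.
  rewrite set0U; apply: card_le_trans AB' _.
  by apply: (card_le_inj (f := pair u)) => // x y _ _ [].
have [->|/set0P[a' Aa']] := eqVneq A' set0.
  rewrite setU0; apply: card_le_trans AB _.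
  by apply: (card_le_inj (f := pair u)) => // x y _ _ [].
have [f [fB finj]] := card_le_fun Aa AB.
have [f' [fB' finj']] := card_le_fun Aa' AB'.
apply: (card_le_inj (f := fun x => if `[< A x >] then (u, f x) else (v, f' x))).
  by move=> x; case: asboolP => [Ax _|nAx []// Ax]; split=> //=;
    [exact: fB|exact: fB'].
move=> x y; case: asboolP => [Ax _|nAx [|Ax]] //;
  case: asboolP => [Ay _|nAy [|Ay]] // [].
- exact: finj.
- by move=> /uv.
- by move=> /esym/uv.
- exact: finj'.
Qed.

(** Hessenberg's theorem.  A maximal injection [F * F -> F] with [F] an infinite
    subset of [A] has [F] as large as [A]: otherwise a copy of [F] is found in
    [A \ F], and the pairs that involve a point of the copy, which are no more
    numerous than [F], can be sent into the copy.  The set [F] is recovered from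
    the graph as the set of [x] such that [(x, x)] has a value. *)
Lemma infinite_square T (A : set T) : infinite_set A -> A `*` A #<= A.
Proof.
move=> Ainf.
pose fld (G : set ((T * T) * T)) := [set x | exists y, G ((x, x), y)].
pose P (G : set ((T * T) * T)) := [/\ fld G `<=` A,
  forall z y, G (z, y) -> (fld G `*` fld G) z /\ fld G y,
  forall z, (fld G `*` fld G) z -> exists y, G (z, y),
  forall z y y', G (z, y) -> G (z, y') -> y = y' &
  forall z z' y, G (z, y) -> G (z', y) -> z = z'].
have fldS G H : G `<=` H -> fld G `<=` fld H.
  by move=> GH x [y Gy]; exists y; exact: GH.
have nat2A : [set: nat * nat] #<= A.
  by rewrite (card_le_eql card_nat2) -infiniteP.
have natA : [set: nat] #<= A by rewrite -infiniteP.
have [j [jA jinj]] := card_le_fun (I : [set: nat] 0) natA.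
have [i iinj] : exists i : nat * nat -> nat, injective i.
  have [|i [_ iinj]] := card_le_fun (I : [set: nat * nat] (0, 0)) (B := [set: nat]).
    by rewrite (card_le_eql card_nat2).
  by exists i => x y; exact: iinj.
(* A countable subset of [A] gives the infinite graph to start from. *)
pose G0 := [set w | exists m n, w = ((j m, j n), j (i (m, n)))].
have fldG0 : fld G0 = range j.
  apply/seteqP; split=> [x [y [m [n [-> _ _]]]]|_ [n _ <-]]; first by exists m.
  by exists (j (i (n, n))), n, n.
have PG0 : P G0.
  split; rewrite ?fldG0.
  - by move=> _ [n _ <-]; exact: jA.
  - move=> _ _ [m [n [-> ->]]]; split; last by exists (i (m, n)).
    by split; [exists m|exists n].
  - by move=> [x x'] [/= [m _ <-] [n _ <-]]; exists (j (i (m, n))), m, n.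
  - move=> z y y' [m [n [-> ->]]] [m' [n' [em en ->]]].
    by rewrite (jinj _ _ I I em) (jinj _ _ I I en).
  - move=> _ _ _ [m [n [-> ->]]] [m' [n' [-> /jinj e]]].
    by have /iinj [-> ->] := e I I.
have [|G [[FA GF Gtot Gfun Ginj] G0G Gmax]] := Zorn_directed PG0.
  move=> W dir; split.
  - move=> x [y Wxy]; have [H [[h _ _ _ _] _ Hxy _]] := dir _ _ Wxy Wxy.
    by apply: h; exists y.
  - move=> z y Wzy; have [H [[_ h _ _ _] HW Hzy _]] := dir _ _ Wzy Wzy.
    have [[h1 h2] h3] := h _ _ Hzy.
    by split; [split|]; exact: (fldS _ _ HW).
  - move=> [x x'] [[y Wy] [y' Wy']].
    have [H [[_ _ h _ _] HW Hy Hy']] := dir _ _ Wy Wy'.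
    have [|t Ht] := h (x, x'); first by split; [exists y|exists y'].
    by exists t; exact: HW.
  - move=> z y y' Wy Wy'; have [H [[_ _ _ h _] _ Hy Hy']] := dir _ _ Wy Wy'.
    exact: h Hy Hy'.
  - move=> z z' y Wy Wy'; have [H [[_ _ _ _ h] _ Hy Hy']] := dir _ _ Wy Wy'.
    exact: h Hy Hy'.
pose F := fld G.
have jF n : F (j n) by apply: (fldS _ _ G0G); rewrite fldG0; exists n.
have F2 : F `*` F #<= F.
  have /choice[f fG] : forall z, exists y, (F `*` F) z -> G (z, y).
    move=> z; have [/Gtot[y ?]|] := pselect ((F `*` F) z); first by exists y.
    by exists z.1.
  apply: (card_le_inj (f := f)) => [x /fG/GF[]//|x y /fG Gx /fG Gy e].
  by rewrite e in Gx; exact: Ginj Gx Gy.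
have j01 : j 0 <> j 1 by move=> /jinj h; have := h I I.
have FU B : B #<= F -> F `|` B #<= F.
  by move=> BF; apply: card_le_trans F2; apply: card_leU j01 _ BF.
suff AF : A #<= F.
  apply: card_le_trans (card_leX AF AF) (card_le_trans F2 _).
  exact: subset_card_le.
have [DF|FD] := card_le_total (A `\` F) F.
  by rewrite -(setDUK FA); exact: FU.
exfalso.
have [b [bD binj]] := card_le_fun (jF 0) FD.
pose F' := F `|` b @` F.
have F'F : F' `*` F' #<= F.
  apply: card_le_trans F2; apply: card_leX; apply: FU; exact: card_image_le.
have F'j : (F' `*` F') (j 0, j 0) by split; left; exact: jF.
have [k [kF kinj]] := card_le_fun F'j F'F.
(* [b] copies [F] into [A \ F], and [k] counts the pairs over [F'] by [F]. *)
pose H := G `|` [set w | [/\ (F' `*` F') w.1, ~ (F `*` F) w.1 & w.2 = b (k w.1)]].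
have HF' : fld H = F'.
  apply/seteqP; split=> x.
    by move=> [y [Gxy|[[/= F'x _] _ _]//]]; left; exists y.
  have [[y Gy] _|nFx F'x] := pselect (F x); first by exists y; left.
  by exists (b (k (x, x))); right; split=> // -[].
have nFb z : (F' `*` F') z -> ~ F (b (k z)).
  by move=> /kF/bD[].
have PH : P H.
  split; rewrite ?HF'.
  - by move=> x [/FA//|[y /bD[Ab _] <-]].
  - move=> z y [/GF[[h1 h2] h3]|[/= F'z _ ->]].
      by split; [split|]; left.
    by split=> //; right; exists (k z) => //; exact: kF.
  - move=> z F'z; have [/Gtot[y Gy]|nFz] := pselect ((F `*` F) z).
      by exists y; left.
    by exists (b (k z)); right.
  - move=> z y y' [h|[/= F'z nFz ->]] [h'|[/= F'z' nFz' ->]] //.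
    + exact: Gfun h h'.
    + by case: nFz'; have [] := GF _ _ h.
    + by case: nFz; have [] := GF _ _ h'.
  - move=> z z' y [h|[/= F'z nFz ->]] [h'|[/= F'z' nFz' e]].
    + exact: Ginj h h'.
    + by case: (nFb _ F'z'); rewrite -e; have [] := GF _ _ h.
    + by case: (nFb _ F'z); have [] := GF _ _ h'.
    + by apply: kinj => //; apply: binj => //; exact: kF.
have HG : H `<=` G by apply: Gmax => // z; left.
have [_ []] := bD _ (jF 0); apply: (fldS _ _ HG); rewrite HF'.
by right; exists (j 0).
Qed.

Fixpoint all_in T (A : set T) (l : seq T) : Prop :=
  if l is x :: l' then A x /\ all_in A l' else True.

(** A sequence is coded by its length and an iterated pairing of its entries;
    the length is what makes the code injective, since nothing separates the
    code of the empty sequence from that of a pair. *)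
Lemma card_le_seqs T U (A : set T) (K : set U) : infinite_set K -> A #<= K ->
  all_in A #<= K.
Proof.
move=> Kinf AK; have K2 := infinite_square Kinf.
have natK : [set: nat] #<= K by rewrite -infiniteP.
have [j [jK jinj]] := card_le_fun (I : [set: nat] 0) natK.
have [k [kK kinj]] := card_le_fun (conj (jK 0 I) (jK 0 I) : (K `*` K) (j 0, j 0)) K2.
have [f [fK finj]] : exists f : T -> U, (forall x, A x -> K (f x)) /\
    (forall x y, A x -> A y -> f x = f y -> x = y).
  have [A0|/set0P[a Aa]] := eqVneq A set0; last exact: card_le_fun Aa AK.
  by exists (fun=> j 0); rewrite A0.
pose code := foldr (fun x c => k (f x, c)) (j 0).
have codeK l : all_in A l -> K (code l).
  elim: l => [_|x l IH [Ax /IH Kl]] /=; first exact: jK.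
  by apply: kK; split=> //; exact: fK.
apply: (card_le_inj (f := fun l => k (j (size l), code l))) => [l Al|l l' Al Al'].
  by apply: kK; split; [exact: jK|exact: codeK].
have Kpair n m : all_in A m -> (K `*` K) (j n, code m).
  by move=> Am; split; [exact: jK|exact: codeK].
move=> /(kinj _ _ (Kpair _ _ Al) (Kpair _ _ Al'))[/jinj].
move=> /(_ I I); elim: l l' Al Al' => [|x l IH] [|y m] //= [Ax Al] [Ay Am] [sz].
move=> /kinj h.
have Kfc z t : A z -> all_in A t -> (K `*` K) (f z, code t).
  by move=> Az At; split; [exact: fK|exact: codeK].
have [/(finj _ _ Ax Ay)-> e] := h (Kfc _ _ Ax Al) (Kfc _ _ Ay Am).
by rewrite (IH _ Al Am).
Qed.

(** * Forcing bounded formulas and the truth lemma *)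

Section Forcing.
Variable P : forcing.

Local Notation name := (is_name P).
Implicit Types p q r s t a b c d : V.

Definition extends p q := p ∈ cond P /\ fle P p q.
Local Notation "p ≼ q" := (extends p q) (at level 70).

Lemma ext_refl p : p ∈ cond P -> p ≼ p.
Proof. by split=> //; exact: fle_refl. Qed.

Lemma ext_trans p q r : r ∈ cond P -> q ≼ r -> p ≼ q -> p ≼ r.
Proof. by move=> cr [cq qr] [cp pq]; split=> //; exact: fle_trans pq qr. Qed.

Lemma name_pair a c s : name a -> kpair c s ∈ a -> s ∈ cond P /\ name c.
Proof. by case=> {}a h /h[t [p [/kpair_inj[-> ->]]]]. Qed.

Lemma dense_below_mono p q (S : V -> Prop) : p ∈ cond P -> q ≼ p ->
  dense_below P p S -> dense_below P q S.
Proof.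
move=> cp [cq qp] dS r cr rq; apply: dS => //.
exact: fle_trans rq qp.
Qed.

(** One inclusion of a forced equality.  The conditions [r] are required to lie
    below [s] from the start, which is easier to use than the defining clause,
    where [q <= s] is a premise met after [q] has been found. *)
Definition half_eq p a b := forall c s r, kpair c s ∈ a -> r ≼ p -> r ≼ s ->
  exists q d t, [/\ q ≼ r, kpair d t ∈ b, fle P q t & forces_eq P q c d].

Lemma forces_eq_sym p a b : forces_eq P p a b -> forces_eq P p b a.
Proof.
move: p b; elim: a / (below_wf a) => a _ IH p b.
move=> e; case: e IH => {}p {}a {}b h1 h2 IH; split=> [d t|c s] k r cr rp.
  have [q [cq qr h]] := h2 d t k r cr rp; exists q; split=> // /h[c [s [ca qs e]]].
  by exists c, s; split=> //; apply: IH e; exact: (pair_below ca).2.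
have [q [cq qr h]] := h1 c s k r cr rp; exists q; split=> // /h[d [t [db qt e]]].
by exists d, t; split=> //; apply: IH e; exact: (pair_below k).2.
Qed.

(** The two forms agree: given [r <= p], either some extension of [r] is below
    [s], and the search starts from it, or the defining clause holds at [r]
    vacuously. *)
Lemma forces_eqP p a b : p ∈ cond P -> name a -> name b ->
  forces_eq P p a b <-> half_eq p a b /\ half_eq p b a.
Proof.
move=> cp Na Nb; split=> [|[h1 h2]].
  suff half a' b' : forces_eq P p a' b' -> name a' -> half_eq p a' b'.
    by move=> e; split; apply: half => //; exact: forces_eq_sym.
  move=> e; case: e cp => {}p {}a' {}b' h _ cp Na' c s r ca [cr rp] [_ rs].
  have [cs _] := name_pair Na' ca.
  have [q [cq qr]] := h c s ca r cr rp.
  case=> [|d [t [db qt e]]]; first exact: fle_trans qr rs.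
  by exists q, d, t.
have half a' b' (S : V -> V -> V -> Prop) : name a' ->
    (forall c s r, kpair c s ∈ a' -> r ≼ p -> r ≼ s ->
      exists q d t, [/\ q ≼ r, kpair d t ∈ b', fle P q t & S q c d]) ->
    forall c s, kpair c s ∈ a' -> dense_below P p (fun q => fle P q s ->
      exists d t, [/\ kpair d t ∈ b', fle P q t & S q c d]).
  move=> Na' h c s ca r cr rp; have [cs _] := name_pair Na' ca.
  have [[q [cq qr] qs]|none] := pselect (exists2 q, q ≼ r & fle P q s).
    have [|//|q' [d [t [[cq' q'q] db q't e]]]] := h c s q ca.
      by split=> //; exact: fle_trans qr rp.
    exists q'; split=> //; first exact: fle_trans q'q qr.
    by move=> _; exists d, t.
  exists r; split=> //; first exact: fle_refl.
  by move=> rs; case: none; exists r => //; split=> //; exact: fle_refl.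
split; first exact: (half a b (forces_eq P)).
apply: (half b a (fun q d c => forces_eq P q c d)) => // d t r db rp rt.
have [q [c [s [qr ca qs e]]]] := h2 d t r db rp rt.
by exists q, c, s; split=> //; exact: forces_eq_sym.
Qed.

Lemma forces_eq_mono p q a b : p ∈ cond P -> q ≼ p ->
  forces_eq P p a b -> forces_eq P q a b.
Proof.
move=> cp qp e; case: e qp cp => {}p {}a {}b h1 h2 qp cp.
by split=> [c s k|d t k]; apply: dense_below_mono qp _ => //; [exact: h1|exact: h2].
Qed.

Lemma forces_eq_refl p a : p ∈ cond P -> name a -> forces_eq P p a a.
Proof.
move: p; elim: a / (below_wf a) => a _ IH p cp Na.
suff half : half_eq p a a by apply/forces_eqP.
move=> c s r ca [cr rp] [_ rs]; have [_ Nc] := name_pair Na ca.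
exists r, c, s; split=> //; first exact: ext_refl.
by apply: IH => //; exact: (pair_below ca).2.
Qed.

Lemma forces_eq_trans p a b c : p ∈ cond P -> name a -> name b -> name c ->
  forces_eq P p a b -> forces_eq P p b c -> forces_eq P p a c.
Proof.
move: p b c; elim: a / (below_wf a) => a _ IH p b c cp Na Nb Nc.
move=> /(forces_eqP cp Na Nb)[ab ba] /(forces_eqP cp Nb Nc)[bc cb].
apply/forces_eqP => //; split.
  move=> x s r xa rp rs; have [q [y [t [qr yb qt e]]]] := ab x s r xa rp rs.
  have [cq _] := qr; have cr := rp.1.
  have [q' [z [u [q'q zc q'u e']]]] := bc y t q yb (ext_trans cp rp qr) (conj cq qt).
  exists q', z, u; split=> //; first exact: ext_trans qr q'q.
  apply: IH (forces_eq_mono cq q'q e) e' => //; [exact: (pair_below xa).2| | | |].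
  - exact: q'q.1.
  - exact: (name_pair Na xa).2.
  - exact: (name_pair Nb yb).2.
  - exact: (name_pair Nc zc).2.
move=> z u r zc rp ru; have [q [y [t [qr yb qt e]]]] := cb z u r zc rp ru.
have [cq _] := qr; have cr := rp.1.
have [q' [x [s [q'q xa q's e']]]] := ba y t q yb (ext_trans cp rp qr) (conj cq qt).
exists q', x, s; split=> //; first exact: ext_trans qr q'q.
apply: forces_eq_sym.
apply: IH (forces_eq_sym e') (forces_eq_sym (forces_eq_mono cq q'q e)) => //.
- exact: (pair_below xa).2.
- exact: q'q.1.
- exact: (name_pair Na xa).2.
- exact: (name_pair Nb yb).2.
- exact: (name_pair Nc zc).2.
Qed.

Lemma forces_mem_intro p a b c s : p ∈ cond P -> kpair c s ∈ b -> s ∈ cond P ->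
  fle P p s -> forces_eq P p a c -> forces_mem P p a b.
Proof.
move=> cp cb cs ps e r cr rp; exists r; split=> //; first exact: fle_refl.
exists c, s; split=> //; first exact: fle_trans rp ps.
exact: forces_eq_mono e.
Qed.

Lemma forces_mem_eql p a a' b : p ∈ cond P -> name a -> name a' -> name b ->
  forces_eq P p a a' -> forces_mem P p a b -> forces_mem P p a' b.
Proof.
move=> cp Na Na' Nb e h r cr rp.
have [q [cq qr [c [s [cb qs e']]]]] := h r cr rp.
exists q; split=> //; exists c, s; split=> //.
apply: (forces_eq_trans (b := a)) => //; first exact: (name_pair Nb cb).2.
apply: forces_eq_sym; apply: forces_eq_mono e => //.
by split=> //; exact: fle_trans qr rp.
Qed.

Lemma forces_mem_eqr p a b b' : p ∈ cond P -> name a -> name b -> name b' ->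
  forces_eq P p b b' -> forces_mem P p a b -> forces_mem P p a b'.
Proof.
move=> cp Na Nb Nb' /(forces_eqP cp Nb Nb')[bb' _] h r cr rp.
have [q [cq qr [c [s [cb qs e]]]]] := h r cr rp.
have qp : q ≼ p by split=> //; exact: fle_trans qr rp.
have [q' [d [t [q'q db' q't e']]]] := bb' c s q cb qp (conj cq qs).
have [cq' q'le] := q'q.
exists q'; split; [by []|exact: fle_trans q'le qr|].
exists d, t; split=> //; apply: (forces_eq_trans (b := c)) (e') => //.
- exact: (name_pair Nb cb).2.
- exact: (name_pair Nb' db').2.
- exact: forces_eq_mono e.
Qed.

Lemma forces_mono p q n (f : sigma0 n) e : p ∈ cond P -> q ≼ p ->
  forces P p f e -> forces P q f e.
Proof.
elim: f e p q => {n} [n i j|n i j|n f _|n f1 IH1 f2 IH2|n i f IH] e p q cp qp /=.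
- exact: dense_below_mono.
- exact: forces_eq_mono.
- by move=> h r cr rq; apply: h => //; have [] := ext_trans cp qp (conj cr rq).
- by move=> [h1 h2]; split; [exact: IH1 h1|exact: IH2 h2].
- exact: dense_below_mono.
Qed.

Lemma name_cons n (e : 'I_n -> V) t : name t -> (forall i, name (e i)) ->
  forall i, name (env_cons t e i).
Proof. by move=> Nt Ne i; rewrite /env_cons; case: unlift. Qed.

(** Names that [p] forces to be equal are interchangeable below [p]. *)
Lemma forces_subst p n (f : sigma0 n) e e' : p ∈ cond P ->
  (forall i, name (e i)) -> (forall i, name (e' i)) ->
  (forall i, forces_eq P p (e i) (e' i)) -> forces P p f e -> forces P p f e'.
Proof.
elim: f e e' p => {n} [n i j|n i j|n f IH|n f1 IH1 f2 IH2|n i f IH] e e' p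
  cp Ne Ne' ee' /=.
- move=> h; apply: (forces_mem_eqr (b := e j)) => //.
  exact: (forces_mem_eql (a := e i)).
- move=> h; apply: (forces_eq_trans (b := e j)) => //.
  apply: (forces_eq_trans (b := e i)) => //; exact: forces_eq_sym.
- move=> h q cq qp k; apply: (h q cq qp); apply: IH k => // i.
  by apply: forces_eq_sym; apply: forces_eq_mono (ee' i).
- by move=> [h1 h2]; split; [apply: IH1 h1|apply: IH2 h2].
- move=> h r cr rp; have [q [cq qr [t [Nt ti k]]]] := h r cr rp.
  have qp : q ≼ p by split=> //; exact: fle_trans qr rp.
  exists q; split=> //; exists t; split=> //.
    by apply: (forces_mem_eqr (b := e i)) => //; exact: forces_eq_mono (ee' i).
  apply: IH k => //; [exact: name_cons|exact: name_cons|].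
  move=> k; rewrite /env_cons; case: unliftP => [l _|_].
    exact: forces_eq_mono (ee' l).
  exact: forces_eq_refl.
Qed.


Definition refutes_mem p a b := forall q, q ≼ p -> ~ forces_mem P q a b.

(** What a filter must know about a formula in order to agree with forcing on
    it.  Where forcing gives only a dense set of witnesses, the positive answer
    asks for an actual pair [kpair c s] of the name with the condition below
    [s]: then [s] is in the filter, and the witness [c] is again a name from the
    hereditary domain of the names in play.  Hence it is enough to consider one
    dense set for each formula with names from that domain, however many
    conditions occur in these names. *)
Definition decides n (f : sigma0 n) : ('I_n -> V) -> V -> Prop :=
  match f with
  | FMem _ i j => fun e p => refutes_mem p (e i) (e j) \/
      exists c s, [/\ kpair c s ∈ e j, fle P p s & forces_eq P p (e i) c]
  | FEq _ i j => fun e p => [\/ forces_eq P p (e i) (e j),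
      exists c s, [/\ kpair c s ∈ e i, fle P p s & refutes_mem p c (e j)] |
      exists c s, [/\ kpair c s ∈ e j, fle P p s & refutes_mem p c (e i)]]
  | FNot _ f => fun e p => forces P p f e \/ forces P p (FNot f) e
  | FAnd _ _ _ => fun _ _ => True
  | FExIn _ i f => fun e p => forces P p (FNot (FExIn i f)) e \/
      exists c s, [/\ kpair c s ∈ e i, fle P p s & forces P p f (env_cons c e)]
  end.

Lemma refutes_or_forces p n (f : sigma0 n) e :
  forces P p (FNot f) e \/ exists2 q, q ≼ p & forces P q f e.
Proof.
have [|none] := pselect (exists2 q, q ≼ p & forces P q f e); first by right.
by left=> q cq qp k; apply: none; exists q.
Qed.

Lemma refutes_mem_or p a b :
  refutes_mem p a b \/ exists2 q, q ≼ p & forces_mem P q a b.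
Proof.
have [|none] := pselect (exists2 q, q ≼ p & forces_mem P q a b); first by right.
by left=> q qp k; apply: none; exists q.
Qed.

(** For a bounded quantifier, forcing provides an arbitrary name [t] forced
    into the bound; below some condition it equals a name [c] that occurs in
    the bound, and [c] replaces [t] by substitution. *)
Lemma decides_dense n (f : sigma0 n) e p : (forall i, name (e i)) ->
  p ∈ cond P -> exists2 q, q ≼ p & decides f e q.
Proof.
case: f e => {n} [n i j|n i j|n f|n f1 f2|n i f] e Ne cp /=.
- have [no|[q qp h]] := refutes_mem_or p (e i) (e j).
    by exists p; [exact: ext_refl|left].
  have [cq _] := qp; have [r [cr rq [c [s h']]]] := h q cq (fle_refl cq).
  by exists r; [exact: ext_trans qp _|right; exists c, s].
- have [yes|no] := pselect (forces_eq P p (e i) (e j)).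
    by exists p; [exact: ext_refl|constructor 1].
  apply: contrapT => none; apply: no; apply/forces_eqP => //.
  suff half a b : name b -> (forall q c s, q ≼ p -> kpair c s ∈ a ->
      fle P q s -> ~ refutes_mem q c b) -> half_eq p a b.
    by split; apply: half => // q c s qp k qs no; apply: none;
      exists q => //; [constructor 2|constructor 3]; exists c, s.
  move=> Nb h c s r ca rp [cr rs].
  have [/(h r c s rp ca rs)//|[q qr cb]] := refutes_mem_or r c b.
  have [cq _] := qr; have [q' [cq' q'q [d [t [db q't e']]]]] := cb q cq (fle_refl cq).
  by exists q', d, t; split=> //; exact: ext_trans qr _.
- have [no|[q qp yes]] := refutes_or_forces p f e.
    by exists p; [exact: ext_refl|right].
  by exists q => //; left.
- by exists p => //; exact: ext_refl.
- have [no|[q qp h]] := refutes_or_forces p (FExIn i f) e.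
    by exists p; [exact: ext_refl|left].
  have [cq _] := qp; have [r [cr rq [t [Nt ti k]]]] := h q cq (fle_refl cq).
  have [r' [cr' r'r [c [s [ci r's tc]]]]] := ti r cr (fle_refl cr).
  have [_ Nc] := name_pair (Ne i) ci.
  exists r'; first by apply: ext_trans qp _; [|apply: ext_trans (conj cr rq) _].
  right; exists c, s; split=> //.
  apply: (forces_subst (e := env_cons t e)) => //; try exact: name_cons.
    move=> l; rewrite /env_cons; case: unliftP => // m _.
    exact: forces_eq_refl.
  by apply: forces_mono k.
Qed.

(** For a filter that decides every formula over a hereditarily closed set [T]
    of names, interpretation agrees with forcing on [T], as it does for generic
    filters. *)
Section Truth.
Variables (T : set V) (g : V).
Hypothesis T_name : forall t, T t -> name t.
Hypothesis T_dom : forall t c s, T t -> kpair c s ∈ t -> T c.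
Hypothesis g_filter : is_filter P g.
Hypothesis g_decides : forall n (f : sigma0 n) e, (forall i, T (e i)) ->
  exists2 p, p ∈ g & decides f e p.

Let g_cond p : p ∈ g -> p ∈ cond P.
Proof. by case: g_filter => h _ _ _; exact: h. Qed.

Let g_up p q : p ∈ g -> q ∈ cond P -> fle P p q -> q ∈ g.
Proof. by case: g_filter => _ _ h _; exact: h. Qed.

Let g_meet p q : p ∈ g -> q ∈ g -> exists2 r, r ∈ g & r ≼ p /\ r ≼ q.
Proof.
case: g_filter => _ _ _ h pg qg; have [r [rg rp rq]] := h _ _ pg qg.
by exists r => //; split; split=> //; exact: g_cond.
Qed.

Let g_mem t c s : T t -> kpair c s ∈ t -> s ∈ g -> eval g c ∈ eval g t.
Proof. by move=> _ ct sg; apply/mem_eval; exists c, s. Qed.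

Let pair_env a b : 'I_2 -> V := fun i => if i == ord0 then a else b.

Let g_decides_mem a b : T a -> T b -> exists2 p, p ∈ g &
  refutes_mem p a b \/
  exists c s, [/\ kpair c s ∈ b, fle P p s & forces_eq P p a c].
Proof.
move=> Ta Tb; apply: (@g_decides _ (FMem ord0 ord_max) (pair_env a b)).
by move=> i; rewrite /pair_env; case: eqP.
Qed.

Let g_decides_eq a b : T a -> T b -> exists2 p, p ∈ g &
  [\/ forces_eq P p a b,
      exists c s, [/\ kpair c s ∈ a, fle P p s & refutes_mem p c b] |
      exists c s, [/\ kpair c s ∈ b, fle P p s & refutes_mem p c a]].
Proof.
move=> Ta Tb; apply: (@g_decides _ (FEq ord0 ord_max) (pair_env a b)).
by move=> i; rewrite /pair_env; case: eqP.
Qed.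

(** Induction on the domain of [a].  If [p] in the filter forces [a = b], then
    for [kpair c s] in [a] with [s] in the filter no condition of the filter
    refutes that [c] is in [b], so a decision yields an element of [b] forced
    equal to [c].  Conversely, a decision against [a = b] names an element of
    one side that is refuted on the other, although their values agree. *)
Lemma truth_eq a b : T a -> T b ->
  (exists2 p, p ∈ g & forces_eq P p a b) <-> eval g a = eval g b.
Proof.
move: b; elim: a / (below_wf a) => a _ IH b Ta Tb.
(* Both claims are stated for a pair [x, y] to serve for [a, b] and [b, a]. *)
have sub_eval x y p : T x -> T y -> p ∈ g -> half_eq p x y ->
    (forall c s d t, kpair c s ∈ x -> kpair d t ∈ y ->
       (exists2 q, q ∈ g & forces_eq P q c d) -> eval g c = eval g d) ->
    sub (eval g x) (eval g y).
  move=> Tx Ty pg xy ev z /mem_eval[c [s [sg cx ->]]].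
  have Tc := T_dom Tx cx.
  have [q qg [no|[d [t [dy qt e]]]]] := g_decides_mem Tc Ty.
    have [r1 r1g [r1p r1s]] := g_meet pg sg.
    have [r rg [rr1 rq]] := g_meet r1g qg.
    have rp := ext_trans (g_cond pg) r1p rr1.
    have rs := ext_trans (g_cond sg) r1s rr1.
    have [q' [d [t [q'r dy q't e]]]] := xy c s r cx rp rs.
    case: (no q'); first exact: ext_trans (g_cond qg) rq q'r.
    have [ct _] := name_pair (T_name Ty) dy.
    by apply: forces_mem_intro dy ct q't e; case: q'r.
  have [ct _] := name_pair (T_name Ty) dy.
  rewrite (ev c s d t cx dy); last by exists q.
  exact: g_mem dy (g_up qg ct qt).
have clash x y p c s : T x -> T y -> p ∈ g -> kpair c s ∈ x -> fle P p s ->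
    refutes_mem p c y -> eval g x = eval g y ->
    (forall d t, kpair d t ∈ y -> eval g c = eval g d ->
       exists2 q, q ∈ g & forces_eq P q c d) -> False.
  move=> Tx Ty pg cx ps no exy ev.
  have [cs _] := name_pair (T_name Tx) cx.
  have := g_mem Tx cx (g_up pg cs ps); rewrite exy => /mem_eval[d [t [tg dy e]]].
  have [q qg eq_cd] := ev d t dy e.
  have [r1 r1g [r1p r1t]] := g_meet pg tg.
  have [r rg [rr1 rq]] := g_meet r1g qg.
  have [cr rt] := ext_trans (g_cond tg) r1t rr1.
  apply: (no r (ext_trans (g_cond pg) r1p rr1)).
  apply: forces_mem_intro dy (g_cond tg) rt _ => //.
  exact: forces_eq_mono (g_cond qg) rq eq_cd.
split=> [[p pg /forces_eqP]|eab].
  case/(_ (g_cond pg) (T_name Ta) (T_name Tb)) => ab ba.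
  apply: V_ext => z; split; [apply: (sub_eval _ _ _ _ _ pg ab)|apply: (sub_eval _ _ _ _ _ pg ba)] => //.
    move=> c s d t ca db; apply (IH c) => //; first exact: (pair_below ca).2.
      exact: T_dom ca.
    exact: T_dom db.
  move=> d t c s db ca [q qg e]; apply: esym; apply (IH c) => //.
  - exact: (pair_below ca).2.
  - exact: T_dom ca.
  - exact: T_dom db.
  - by exists q => //; exact: forces_eq_sym.
have [p pg [e|[c [s [ca ps no]]]|[d [t [db pt no]]]]] := g_decides_eq Ta Tb.
- by exists p.
- exfalso; apply: (clash _ _ _ _ _ Ta Tb pg ca ps no eab) => // d t db e.
  apply/IH => //; [exact: (pair_below ca).2|exact: T_dom ca|exact: T_dom db].
- exfalso; apply: (clash _ _ _ _ _ Tb Ta pg db pt no (esym eab)) => // c s ca e.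
  have [q qg e'] : exists2 q, q ∈ g & forces_eq P q c d.
    by apply/IH => //; [exact: (pair_below ca).2|exact: T_dom ca|exact: T_dom db].
  by exists q => //; exact: forces_eq_sym.
Qed.

Lemma truth n (f : sigma0 n) e : (forall i, T (e i)) ->
  (exists2 p, p ∈ g & forces P p f e) <-> holds f (fun i => eval g (e i)).
Proof.
have clash p q n0 (f0 : sigma0 n0) e0 : p ∈ g -> q ∈ g ->
    forces P p (FNot f0) e0 -> forces P q f0 e0 -> False.
  move=> pg qg no yes; have [r rg [[cr rp] rq]] := g_meet pg qg.
  by apply: (no r cr rp); apply: forces_mono yes => //; exact: g_cond.
elim: f e => {n} [n i j|n i j|n f IH|n f1 IH1 f2 IH2|n i f IH] e Te /=.
- split=> [[p pg h]|/mem_eval[c [s [sg cj e']]]].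
    have [q qg [no|[c [s [cj qs e']]]]] := g_decides_mem (Te i) (Te j).
      have [r rg [rp rq]] := g_meet pg qg; case: (no r rq).
      by apply: dense_below_mono h => //; exact: g_cond.
    have [cs _] := name_pair (T_name (Te j)) cj.
    have -> : eval g (e i) = eval g c.
      by apply/truth_eq; [|exact: T_dom cj|exists q].
    exact: g_mem cj (g_up qg cs qs).
  have [q qg k] : exists2 q, q ∈ g & forces_eq P q (e i) c.
    by apply/truth_eq => //; exact: T_dom cj.
  have [r rg [rq [cr rs]]] := g_meet qg sg; exists r => //.
  apply: forces_mem_intro cj (g_cond sg) rs _ => //.
  exact: forces_eq_mono (g_cond qg) rq k.
- exact: truth_eq.
- split=> [[p pg h] /IH[]// q qg k|h]; first exact: (clash _ _ _ _ _ pg qg h k).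
  have [p pg [k|k]] := g_decides (FNot f) Te; last by exists p.
  by case: h; apply/IH => //; exists p.
- split=> [[p pg [h1 h2]]|[/IH1[]// p pg h1 /IH2[]// q qg h2]].
    by split; [apply/IH1|apply/IH2] => //; exists p.
  have [r rg [rp rq]] := g_meet pg qg; exists r => //.
  by split; [apply: forces_mono h1|apply: forces_mono h2] => //; exact: g_cond.
- have env c : (fun k => eval g (env_cons c e k)) =
      env_cons (eval g c) (fun k => eval g (e k)).
    by apply: funext => k; rewrite /env_cons; case: unlift.
  have Tc c s : kpair c s ∈ e i -> forall k, T (env_cons c e k).
    by move=> ci k; rewrite /env_cons; case: unlift => //; exact: T_dom ci.
  split=> [[p pg h]|[_ /mem_eval[c [s [sg ci ->]]]]].
    have [q qg [no|[c [s [ci qs k]]]]] := g_decides (FExIn i f) Te.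
      by case: (clash _ _ _ _ _ qg pg no h).
    have [cs _] := name_pair (T_name (Te i)) ci.
    exists (eval g c); first exact: g_mem ci (g_up qg cs qs).
    by rewrite -env; apply/IH; [exact: Tc ci|exists q].
  rewrite -env => /IH[|q qg k]; first exact: Tc ci.
  have [r rg [rq [cr rs]]] := g_meet qg sg; exists r => // r' cr' r'r.
  have [_ Nc] := name_pair (T_name (Te i)) ci.
  exists r'; split=> //; first exact: fle_refl.
  exists c; split=> //.
    apply: forces_mem_intro ci (g_cond sg) _ _ => //; last exact: forces_eq_refl.
    by have [] := ext_trans (g_cond sg) (conj cr rs) (conj cr' r'r).
  by apply: forces_mono k; [exact: g_cond|exact: ext_trans (g_cond qg) rq _].
Qed.

End Truth.
End Forcing.

(** * Forcing axioms for indexed families *)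

Definition densely (P : forcing) (S : set V) : Prop :=
  forall p, p ∈ cond P -> exists2 q, extends P q p & S q.

(** The forcing axiom for families of dense properties indexed by an arbitrary
    set [J]; in this form it depends on the cardinality of [J] alone. *)
Definition FA_on (P : forcing) I (J : set I) : Prop :=
  forall D : I -> set V, (forall i, J i -> densely P (D i)) ->
  exists2 g, is_filter P g & forall i, J i -> exists2 p, p ∈ g & D i p.

Lemma one_in_filter (P : forcing) g : is_filter P g -> one P ∈ g.
Proof.
move=> [gc [p pg] up _]; apply: up (pg) (one_cond P) _.
by apply: fle_one; exact: gc.
Qed.

Lemma FA_on_le (P : forcing) I I' (J : set I) (J' : set I') :
  J #<= J' -> FA_on P J' -> FA_on P J.
Proof.
move=> JJ' fa D Dd; have [->|/set0P[i0 Ji0]] := eqVneq J set0.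
  have [|g gf _] := fa (fun=> setT); last by exists g.
  by move=> i _ p cp; exists p => //; split=> //; exact: fle_refl.
have [f [fJ finj]] := card_le_fun Ji0 JJ'.
have [i' _ p cp|g gf gD] := fa (fun i' p => forall i, J i -> f i = i' -> D i p).
  have [[i [Ji <-]]|none] := pselect (exists i, J i /\ f i = i').
    have [q qp Dq] := Dd i Ji p cp; exists q => // i1 Ji1 e.
    by rewrite (finj _ _ Ji1 Ji e).
  exists p; first by split=> //; exact: fle_refl.
  by move=> i Ji e; case: none; exists i.
exists g => // i Ji; have [p pg h] := gD _ (fJ i Ji).
by exists p => //; exact: h.
Qed.

Lemma FA_on_elts (P : forcing) k : FA P k -> FA_on P (elts k).
Proof.
move=> fa D Dd; have [c ck|g gf gD] := fa (fun c => sep (cond P) (D c)).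
  split=> [p /mem_sep[]//|p cp]; have [q [cq qp] Dq] := Dd c ck p cp.
  by exists q => //; apply/mem_sep.
by exists g => // c ck; have [p pg /mem_sep[_ Dp]] := gD c ck; exists p.
Qed.

(** The Rasiowa-Sikorski lemma: countably many dense sets are met along a
    descending sequence of conditions, whose upward closure is the filter. *)
Lemma FA_on_nat (P : forcing) : FA_on P [set: nat].
Proof.
move=> D Dd.
have /choice[next nextP] : forall z : nat * V, exists q, z.2 ∈ cond P ->
    extends P q z.2 /\ D z.1 q.
  move=> [n p] /=; have [cp|] := pselect (p ∈ cond P); last by exists p.
  by have [q qp Dq] := Dd n I p cp; exists q.
pose fix u n := if n is m.+1 then next (m, u m) else one P.
have cu n : u n ∈ cond P.
  by elim: n => [|n IH] /=; [exact: one_cond|have [[]] := nextP (n, u n) IH].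
have uS n : fle P (u n.+1) (u n) by have [[]] := nextP (n, u n) (cu n).
have uD n m : fle P (u (n + m)) (u n).
  elim: m => [|m IH]; first by rewrite addn0; exact: fle_refl.
  by rewrite addnS; apply: fle_trans (uS _) IH.
exists (sep (cond P) (fun p => exists n, fle P (u n) p)).
  split=> [p /mem_sep[]//||p q /mem_sep[cp [n up]] cq pq|].
  - by exists (one P); apply/mem_sep; split; [exact: one_cond|exists 0; exact: fle_refl (cu 0)].
  - by apply/mem_sep; split=> //; exists n; exact: fle_trans up pq.
  - move=> p q /mem_sep[cp [n np]] /mem_sep[cq [m mq]]; exists (u (n + m)); split.
    + by apply/mem_sep; split=> //; exists (n + m); exact: fle_refl.
    + exact: fle_trans np.
    + by apply: fle_trans mq => //; rewrite addnC.
move=> n _; exists (u n.+1); last by have [] := nextP (n, u n) (cu n).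
by apply/mem_sep; split=> //; exists n.+1; exact: fle_refl.
Qed.

(** * Counting formulas and names *)

(** Formulas are countable because they embed into the countable type of trees
    labelled by natural numbers. *)
Fixpoint formula_tree n (f : sigma0 n) : GenTree.tree nat :=
  match f with
  | FMem _ i j => GenTree.Node 0 [:: GenTree.Leaf (i : nat); GenTree.Leaf (j : nat)]
  | FEq _ i j => GenTree.Node 1 [:: GenTree.Leaf (i : nat); GenTree.Leaf (j : nat)]
  | FNot _ f => GenTree.Node 2 [:: formula_tree f]
  | FAnd _ f1 f2 => GenTree.Node 3 [:: formula_tree f1; formula_tree f2]
  | FExIn _ i f => GenTree.Node 4 [:: GenTree.Leaf (i : nat); formula_tree f]
  end.

Lemma formula_tree_inj n : injective (@formula_tree n).
Proof.
elim=> {n} [n i j|n i j|n f IH|n f1 IH1 f2 IH2|n i f IH] g.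
- by case: n / g i j => //= n i j i' j' [/val_inj-> /val_inj->].
- by case: n / g i j => //= n i j i' j' [/val_inj-> /val_inj->].
- by case: n / g f IH => //= n g f IH [/IH->].
- by case: n / g f1 f2 IH1 IH2 => //= n g1 g2 f1 f2 IH1 IH2 [/IH1-> /IH2->].
- by case: n / g i f IH => //= n i' g i f IH [/val_inj-> /IH->].
Qed.

Definition instance := {n & (sigma0 n * ('I_n -> V))%type}.

Definition instances (T : set V) : set instance :=
  [set x | forall i, T ((projT2 x).2 i)].

Lemma card_instances U (K : set U) (T : set V) : infinite_set K -> T #<= K ->
  instances T #<= K.
Proof.
move=> Kinf TK; have K2 := infinite_square Kinf.
have natK : [set: nat] #<= K by rewrite -infiniteP.
pose code (x : instance) : nat * (nat * seq V) :=
  (projT1 x, (pickle (formula_tree (projT2 x).1),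
    [seq (projT2 x).2 i | i <- enum 'I_(projT1 x)])).
apply: (@card_le_trans _ _ _ (setT `*` (setT `*` all_in T))).
  apply: (card_le_inj (f := code)) => [[n [f e]] /= Te|].
    split=> //=; split=> //=; rewrite /instances /= in Te.
    by elim: (enum _) => //= i l IH; split.
  move=> [n [f e]] [n' [f' e']] _ _ [/= en]; case: n' / en f' e' => f' e'.
  move=> /(pcan_inj pickleK)/formula_tree_inj -> /eq_in_map ee'.
  by do 2!congr existT || congr pair; apply: funext => i; apply: ee'; rewrite mem_enum.
apply: card_le_trans (K2); apply: card_leX => //.
apply: card_le_trans (K2); apply: card_leX => //.
exact: card_le_seqs.
Qed.

(** If every point has at most [K] successors, then at most [K] points can be
    reached from at most [K] roots: enumerate the successors of each point by
    elements of [C]; a reachable point is then named by a root and a finite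
    sequence of elements of [C]. *)
Lemma card_reachable T U W (R : T -> T -> Prop) (A : set T) (C : set U) (K : set W) :
  infinite_set K -> A #<= K -> C #<= K ->
  (forall a x, A a -> clos_refl_trans_n1 T R a x -> [set y | R x y] #<= C) ->
  [set x | exists2 a, A a & clos_refl_trans_n1 T R a x] #<= K.
Proof.
move=> Kinf AK CK RC.
pose reach x := exists2 a, A a & clos_refl_trans_n1 T R a x.
have /choice[h hP] : forall x, exists h : U -> T, reach x ->
    forall y, R x y -> exists2 c, C c & h c = y.
  move=> x; have [[a Aa ax]|] := pselect (reach x); last by exists (fun=> x).
  have [R0|/set0P[y0 Ry0]] := eqVneq [set y | R x y] set0.
    by exists (fun=> x) => _ y Rxy; have : [set y | R x y] y by []; rewrite R0.
  have [f [fC finj]] := card_le_fun Ry0 (RC a x Aa ax).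
  have /choice[h hP] : forall c, exists y, forall y', R x y' -> f y' = c -> y = y'.
    move=> c; have [[y [Ry <-]]|none] := pselect (exists y, R x y /\ f y = c).
      by exists y => y' Ry' /(finj _ _ Ry' Ry).
    by exists x => y' Ry' e; case: none; exists y'.
  by exists h => _ y Ry; exists (f y); [exact: fC|exact: hP].
pose walk (z : T * seq U) := foldr (fun c x => h x c) z.1 z.2.
apply: (@card_le_trans _ _ _ (walk @` (A `*` all_in C))).
  apply: subset_card_le => x [a Aa]; elim=> [|y z Ryz ay [[b l] [/= Ab Cl] e]].
    by exists (a, [::]).
  have [|c Cc hc] := hP y _ z Ryz; first by exists a.
  by exists (b, c :: l) => //; rewrite -hc -e.
apply: card_le_trans (card_image_le _ _) _.
apply: card_le_trans (infinite_square Kinf); apply: card_leX => //.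
exact: card_le_seqs.
Qed.

(** The hereditary domain [T] of finitely many [k]-small names has size at most
    [K], where [K] is [k] if [k] is infinite and the set of natural numbers
    otherwise; so there are at most [K] formulas over [T] to decide.  If [k] is
    finite, they can be decided in any forcing whatsoever. *)
Lemma FA_simultaneous (P : forcing) k n (s : 'I_n.+1 -> V) : FA P k ->
  (forall i, is_name P (s i) /\ small_name P k (s i)) -> simultaneous P s.
Proof.
move=> fa hs.
pose R t u := u ∈ dom P t.
pose T := [set t | exists2 a, range s a & clos_refl_trans_n1 V R a t].
have Tinv t : T t -> is_name P t /\ small_name P k t.
  move=> [_ [i _ <-]]; elim=> [|x y /mem_names_with[p cp xy] _ [Nx Sx]]; first exact: hs.
  split; first exact: (name_pair Nx xy).2.
  by case: Sx xy {Nx} => {}x _ h xy; apply: h; apply/mem_names_with; exists p.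
have Tname t : T t -> is_name P t by case/Tinv.
have Tdom t c q : T t -> kpair c q ∈ t -> T c.
  move=> Tt ct; have [cq _] := name_pair (Tname t Tt) ct.
  case: Tt => a sa at'; exists a => //; apply: rtn1_trans at'.
  by apply/mem_names_with; exists q.
have [U [K [Kinf kK faK]]] : exists U (K : set U),
    [/\ infinite_set K, elts k #<= K & FA_on P K].
  have [kfin|kinf] := pselect (finite_set (elts k)).
    exists nat, setT; split; [exact: infinite_nat| |exact: FA_on_nat].
    exact: finite_set_countable.
  by exists V, (elts k); split=> //; exact: FA_on_elts.
have natK : [set: nat] #<= K by rewrite -infiniteP.
have TK : T #<= K.
  apply: (card_reachable (C := elts k)) => //.
    apply: card_le_trans (card_image_le _ _) _; apply: card_le_trans natK.
    exact: countableP.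
  move=> a t sa at'; have [_] := Tinv t (ex_intro2 _ _ a sa at').
  by case.
have [x Tx p cp|g gf gD] :=
    FA_on_le (card_instances Kinf TK) faK (D := fun x => decides P (projT2 x).1 (projT2 x).2).
  by apply: decides_dense => // i; exact: Tname.
exists g => // f h.
apply/(truth Tname Tdom gf) => [m f0 e Te|i|].
- exact: (gD (existT _ m (f0, e))).
- by exists (s i); [exists i|exact: rtn1_refl].
- by exists (one P) => //; exact: one_in_filter.
Qed.

(** * Ordinals and iterated power sets *)

Lemma mem_min (S : V -> Prop) x : S x ->
  exists2 y, S y & forall z, z ∈ y -> ~ S z.
Proof.
elim: x / (mem_wf x) => x _ IH Sx.
have [[y yx Sy]|none] := pselect (exists2 y, y ∈ x & S y); first exact: IH Sy.
by exists x => // z zx Sz; apply: none; exists z.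
Qed.

Lemma ordinal_mem a b : ordinal a -> b ∈ a -> ordinal b.
Proof.
move=> [ta oa] ba; split; first exact: oa.
by move=> c cb; apply: oa; exact: ta cb.
Qed.

Lemma ordinal_total a b : ordinal a -> ordinal b -> [\/ a ∈ b, a = b | b ∈ a].
Proof.
move: b; elim: a / (mem_wf a) => a _ IHa b; elim: b / (mem_wf b) => b _ IHb oa ob.
apply: contrapT => no.
have ab z : z ∈ a -> z ∈ b.
  move=> za; have [//|zb|bz] := IHa z za b (ordinal_mem oa za) ob.
    by case: no; constructor 3; rewrite -zb.
  by case: no; constructor 3; apply: oa.1 za _ bz.
have ba z : z ∈ b -> z ∈ a.
  move=> zb; have [az|az|//] := IHb z zb oa (ordinal_mem ob zb).
    by case: no; constructor 1; apply: ob.1 zb _ az.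
  by case: no; constructor 1; rewrite az.
by apply: no; constructor 2; apply: V_ext => z; split; [exact: ab|exact: ba].
Qed.

Lemma mem_irrefl a : ~ a ∈ a.
Proof. by elim: a / (mem_wf a) => a _ IH aa; exact: (IH a aa). Qed.

Lemma ordinal_sub a b : ordinal a -> ordinal b -> sub a b -> ord_le a b.
Proof.
move=> oa ob ab; have [|->|ba] := ordinal_total oa ob; [by left|by right|].
by case: (mem_irrefl (ab b ba)).
Qed.

Lemma ord_le_mem a b c : ordinal c -> ord_le a b -> b ∈ c -> a ∈ c.
Proof. by move=> [tc _] [ab|->//] bc; exact: tc ab. Qed.

Lemma ord_le_sub a b : ordinal b -> ord_le a b -> sub a b.
Proof. by move=> [tb _] [ab|->//] z za; exact: tb za. Qed.

Lemma ordinal0 : ordinal empty.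
Proof. by split=> [y /mem_empty//|y /mem_empty]. Qed.

Lemma ord_le0 a : ordinal a -> ord_le empty a.
Proof. by move=> oa; apply: ordinal_sub => // [|z /mem_empty//]; exact: ordinal0. Qed.

Lemma Pow_ltE X a z : z ∈ Pow_lt X a <-> exists2 b, b ∈ a & z ∈ Pow X b.
Proof.
rewrite /Pow_lt mem_union; split=> [[_ /mem_repl[b ba ->] zb]|[b ba zb]].
  by exists b.
by exists (Pow X b) => //; apply/mem_repl; exists b.
Qed.

Lemma mem_Pow_pos X a z : a <> empty -> z ∈ Pow X a <-> sub z (Pow_lt X a).
Proof. by move=> a0; rewrite Pow_pos // mem_powerset. Qed.

Lemma size_le_sub x y : sub x y -> size_le x y.
Proof. by move=> xy; apply: subset_card_le => z; exact: xy. Qed.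

Lemma size_le_trans x y z : size_le x y -> size_le y z -> size_le x z.
Proof. exact: card_le_trans. Qed.

Lemma size_le_repl f x : size_le (repl f x) x.
Proof.
apply: card_le_trans (card_image_le f (elts x)).
by apply: subset_card_le => z /mem_repl[y yx ->]; exists y.
Qed.

Lemma transitive_hered_small k X : transitive_set X -> size_le X k ->
  forall x, x ∈ X -> hered_small k x.
Proof.
move=> tX Xk x; elim: x / (mem_wf x) => x _ IH xX; constructor.
  by apply: size_le_trans Xk; apply: size_le_sub => z; exact: tX.
by move=> y yx; apply: IH => //; exact: tX yx.
Qed.

(** If all levels below [b] have size at most [k], then a set in one of them is
    a subset of a smaller such level, or an element of the transitive set [X];
    so it is hereditarily of size at most [k]. *)
Lemma Pow_lt_hered_small k X b : transitive_set X -> size_le X k -> ordinal b ->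
  (forall c, c ∈ b -> size_le (Pow_lt X c) k) ->
  forall y, y ∈ Pow_lt X b -> hered_small k y.
Proof.
move=> tX Xk ob small y /Pow_ltE[c cb yc]; move: y cb yc.
elim: c / (mem_wf c) => c _ IH y cb yc.
have [c0|c0] := pselect (c = empty).
  by move: yc; rewrite c0 Pow0; exact: transitive_hered_small.
move: yc => /(mem_Pow_pos _ _ c0) yc; constructor.
  exact: size_le_trans (size_le_sub yc) (small c cb).
move=> z /yc/Pow_ltE[d dc zd]; apply: IH zd => //; exact: ob.1 dc.
Qed.

(** * Canonical names and the name principle *)

Section Check.
Variable P : forcing.
Implicit Types x y A X k : V.

Lemma mem_check x z : z ∈ check P x <-> exists2 y, y ∈ x & z = kpair (check P y) (one P).
Proof. by rewrite checkE mem_repl. Qed.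

Lemma dom_check x : dom P (check P x) = repl (check P) x.
Proof.
apply: V_ext => z; rewrite mem_names_with mem_repl; split.
  by move=> [p _ /mem_check[y yx /kpair_inj[-> _]]]; exists y.
move=> [y yx ->]; exists (one P); first exact: one_cond.
by apply/mem_check; exists y.
Qed.

Lemma check_name x : is_name P (check P x).
Proof.
elim: x / (mem_wf x) => x _ IH; constructor=> z /mem_check[y yx ->].
by exists (check P y), (one P); split=> //; [exact: one_cond|exact: IH].
Qed.

Lemma check_small k x : hered_small k x -> small_name P k (check P x).
Proof.
elim: x / (mem_wf x) => x _ IH hx; case: hx IH => {}x xk h IH.
constructor; rewrite dom_check; first exact: size_le_trans (size_le_repl _ _) xk.
by move=> t /mem_repl[y yx ->]; exact: (IH y yx (h y yx)).
Qed.

Lemma eval_check g x : one P ∈ g -> eval g (check P x) = x.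
Proof.
move=> g1; elim: x / (mem_wf x) => x _ IH.
apply: V_ext => z; rewrite mem_eval; split.
  by move=> [t [p [_ /mem_check[y yx /kpair_inj[-> _]] ->]]]; rewrite IH.
move=> zx; exists (check P z), (one P); split=> //; last by rewrite IH.
by apply/mem_check; exists z.
Qed.

(** The rank is either empty or a union of successors of elements of [a]; in the
    second case it is a transitive subset of [a], hence an ordinal at most [a]. *)
Lemma name_rank_le X s a : ordinal a ->
  (forall t, t ∈ dom P s -> name_rank P X t ∈ a) -> ord_le (name_rank P X s) a.
Proof.
move=> oa h; have [isx|notx] := pselect (exists2 x, x ∈ X & s = check P x).
  by rewrite name_rank0 //; exact: ord_le0.
rewrite name_rank_pos //; set u := union _.
have uP z : z ∈ u -> exists2 t, t ∈ dom P s & ord_le z (name_rank P X t).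
  move=> /mem_union[_ /mem_repl[_ /mem_repl[t ts ->] ->] /mem_succ zt].
  by exists t.
have ua : sub u a.
  by move=> z /uP[t ts zt]; exact: ord_le_mem zt (h t ts).
apply: ordinal_sub => //; split; last by move=> b /ua; exact: oa.2.
move=> z zu y yz; have [t ts zt] := uP z zu.
have ot := ordinal_mem oa (h t ts).
apply/mem_union; exists (succ (name_rank P X t)).
  by apply/mem_repl; exists (name_rank P X t) => //; apply/mem_repl; exists t.
by apply/mem_succ; left; exact: (ord_le_sub ot zt).
Qed.

(** Canonical names follow the levels, since the elements of a set in a positive
    level lie in lower levels.  This is what allows the simultaneous principle
    to be applied to the canonical name of [A] next to the given name. *)
Lemma check_rank X a A : ordinal a -> A ∈ Pow X a ->
  ord_le (name_rank P X (check P A)) a.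
Proof.
move: A; elim: a / (mem_wf a) => a _ IH A oa.
have [->|a0] := pselect (a = empty).
  by rewrite Pow0 => AX; right; apply: name_rank0; exists A.
move=> /(mem_Pow_pos _ _ a0) Aa; apply: name_rank_le => // t.
rewrite dom_check => /mem_repl[y /Aa/Pow_ltE[b ba yb] ->].
exact: ord_le_mem (IH b ba y (ordinal_mem oa ba) yb) ba.
Qed.

Lemma simultaneous_eq s A : simultaneous P (fun i : 'I_2 => if i == ord0 then s else check P A) ->
  forces_eq P (one P) s (check P A) -> exists2 g, is_filter P g & eval g s = A.
Proof.
move=> [g gf h] e; exists g => //.
by have := h (FEq ord0 ord_max) e; rewrite /= eval_check //; exact: one_in_filter.
Qed.

(** For an injective [f], a filter [g] evaluates this name to the full range of
    [f] on [k] exactly when it meets every [D c]. *)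
Definition meeting_name k (f D : V -> V) : V :=
  union (repl (fun c => repl (fun p => kpair (check P (f c)) p) (D c)) k).

Lemma mem_meeting_name k f D z : z ∈ meeting_name k f D <->
  exists c p, [/\ c ∈ k, p ∈ D c & z = kpair (check P (f c)) p].
Proof.
rewrite /meeting_name mem_union; split.
  by move=> [_ /mem_repl[c ck ->] /mem_repl[p pD ->]]; exists c, p.
move=> [c [p [ck pD ->]]].
exists (repl (fun p => kpair (check P (f c)) p) (D c)); apply/mem_repl.
  by exists c.
by exists p.
Qed.

(** If all the [D c] are dense, [meeting_name k f D] is forced to be the range
    of [f], so the name principle for it yields a filter as required.  The range
    of [f] has to consist of hereditarily small sets, whereas the level
    [Pow_lt X a] may contain large ones.  Therefore [f] takes its values in
    [Pow_lt X b] for the least [b] such that this level has size at least [k]: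
    all levels below it have size at most [k]. *)
Lemma Name_principle_FA X k a : ordinal a -> a <> empty -> transitive_set X ->
  size_le X k -> size_le k (Pow_lt X a) -> Name_principle P X k a -> FA P k.
Proof.
move=> oa a0 tX Xk ka NP.
have [b [ba kb] bmin] := mem_min
  (S := fun b => ord_le b a /\ size_le k (Pow_lt X b)) (conj (or_intror erefl) ka).
have ob : ordinal b by case: ba => [/(ordinal_mem oa)|->].
have hb : forall y, y ∈ Pow_lt X b -> hered_small k y.
  apply: Pow_lt_hered_small => // c cb.
  have [//|kc] := card_le_total (elts (Pow_lt X c)) (elts k).
  case: (bmin c cb); split=> //; left.
  by case: ba => [ba|<-//]; exact: oa.1 ba _ cb.
have Pba : sub (Pow_lt X b) (Pow_lt X a).
  move=> y /Pow_ltE[c cb yc]; apply/Pow_ltE; exists c => //.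
  exact: ord_le_sub oa ba _ cb.
have [f [fb finj]] : exists f : V -> V, (forall c, c ∈ k -> f c ∈ Pow_lt X b) /\
    (forall c d, c ∈ k -> d ∈ k -> f c = f d -> c = d).
  have [k0|/set0P[c ck]] := eqVneq (elts k) set0.
    have k0' c : ~ c ∈ k by move=> ck; have : elts k c by []; rewrite k0.
    by exists id; split=> c ?; have := k0' c.
  exact: card_le_fun ck kb.
move=> D Dd; pose s := meeting_name k f D; pose A := repl f k.
have dom_s t : t ∈ dom P s -> exists2 c, c ∈ k & t = check P (f c).
  by move=> /mem_names_with[p _ /mem_meeting_name[c [q [ck _ /kpair_inj[-> _]]]]]; exists c.
have Ns : is_name P s.
  constructor=> z /mem_meeting_name[c [p [ck pD ->]]].
  exists (check P (f c)), p; split=> //; [exact: (Dd c ck).1|exact: check_name].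
have [|||||g gf gA] := NP s A.
- split=> //; apply: name_rank_le => // t /dom_s[c ck ->].
  have /Pow_ltE[d da yd] := Pba _ (fb c ck).
  exact: ord_le_mem (check_rank (ordinal_mem oa da) yd) da.
- constructor=> [|t /dom_s[c ck ->]]; last by apply: check_small; exact/hb/fb.
  apply: size_le_trans (size_le_repl (fun c => check P (f c)) k).
  by apply: size_le_sub => t /dom_s[c ck ->]; apply/mem_repl; exists c.
- by constructor=> [|y /mem_repl[c ck ->]]; [exact: size_le_repl|exact/hb/fb].
- by apply/(mem_Pow_pos _ _ a0) => y /mem_repl[c ck ->]; exact/Pba/fb.
- apply/forces_eqP => //; [exact: one_cond|exact: check_name|split].
    move=> t p r /mem_meeting_name[c [q [ck qD /kpair_inj[-> ->]]]] [cr r1] _.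
    exists r, (check P (f c)), (one P); split=> //.
    + by split=> //; exact: fle_refl.
    + by apply/mem_check; exists (f c) => //; apply/mem_repl; exists c.
    + by apply: forces_eq_refl => //; exact: check_name.
  move=> t p r /mem_check[_ /mem_repl[c ck ->] /kpair_inj[-> ->]] [cr r1] _.
  have [DP Dc] := Dd c ck; have [q qD qr] := Dc r cr; have cq := DP q qD.
  exists q, (check P (f c)), q; split=> //.
  + by apply/mem_meeting_name; exists c, q.
  + exact: fle_refl.
  + by apply: forces_eq_refl => //; exact: check_name.
exists g => // c ck; have : f c ∈ eval g s by rewrite gA; apply/mem_repl; exists c.
move=> /mem_eval[t [p [pg /mem_meeting_name[d [q [dk qD /kpair_inj[-> epq]]]]]]].
rewrite eval_check; last exact: one_in_filter.
by move=> /(finj _ _ ck dk)->; exists p => //; rewrite epq.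
Qed.

End Check.

Theorem theorem4p1 (P : forcing) (kappa : V) (hkappa : cardinal kappa) :
  ((FA P kappa -> Sigma0_sim_N_inf P kappa) /\
   (Sigma0_sim_N_inf P kappa -> Name_principle_inf P kappa) /\
   (Name_principle_inf P kappa -> FA P kappa)) /\
  (forall alpha X : V,
     ordinal alpha -> empty ∈ alpha ->
     transitive_set X -> size_le X kappa ->
     (FA P kappa -> Sigma0_sim_N P X kappa alpha) /\
     (Sigma0_sim_N P X kappa alpha -> Name_principle P X kappa alpha) /\
     (size_le kappa (Pow_lt X alpha) ->
        Name_principle P X kappa alpha -> FA P kappa)).
Proof.
split; [split; [|split]|move=> a X oa a0 tX Xk; split; [|split]].
- move=> fa n s [X [_ _ hs]]; apply: (FA_simultaneous fa) => i.
  by have [[a _ [Ns _]] Ss] := hs i.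
- move=> sim a X oa tX hX s A [Ns rs] Ss hA AX; apply: simultaneous_eq.
  apply: sim; exists X; split; [exact: tX|exact: hX|move=> i; case: eqP => _].
    by split; [exists a|exact: Ss].
  split; last exact: check_small.
  by exists a => //; split; [exact: check_name|exact: check_rank].
- have [ok _] := hkappa.
  have o1 : ordinal (succ empty).
    have e y : y ∈ succ empty -> y = empty by move=> /mem_succ[/mem_empty|].
    by split=> [y /e-> z /mem_empty|y /e->]; last exact: ordinal0.1.
  have e1 : empty ∈ succ empty by apply/mem_succ; right.
  (* The cardinal itself serves as base: [Pow_lt kappa 1] is [kappa]. *)
  move=> NP; apply: (@Name_principle_FA P kappa kappa (succ empty)) => //.
  + by move=> e; apply: (@mem_empty empty); rewrite -{2}e.
  + exact: ok.1.
  + exact: card_lexx.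
  + apply: size_le_sub => z zk; apply/Pow_ltE; exists empty => //.
    by rewrite Pow0.
  + apply: NP; [exact: o1|exact: ok.1|].
    constructor; first exact: card_lexx.
    by apply: transitive_hered_small; [exact: ok.1|exact: card_lexx].
- move=> fa n s hs; apply: (FA_simultaneous fa) => i.
  by have [[Ns _] Ss] := hs i.
- move=> sim s A rs Ss hA AX; apply: simultaneous_eq; apply: sim => i.
  case: eqP => _; first by split; [exact: rs|exact: Ss].
  split; last exact: check_small.
  by split; [exact: check_name|exact: check_rank].
- move=> ka; apply: Name_principle_FA => // e.
  by apply: (@mem_empty empty); rewrite -{2}e.
Qed.
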